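(* Let $f:\mathbb{R}^n_{>0}\to\mathbb{R}^n_{>0}$ be order-preserving, homogeneous, and multiplicatively convex. (a) $E(f)$ is nonempty and bounded in $(\mathbb{R}^n_{>0},d_H)$ if and only if $f$ is strongly nonnegative and $\mathcal{G}(f)$ has only one final class. (b) If $f$ is strongly nonnegative, then $E(f)$ is nonempty. (c) If $f$ is real analytic and $E(f)$ is nonempty, then $f$ is strongly nonnegative.
   Context: $[n]=\{1,\dots,n\}$; entrywise order. Order-preserving: $x\le y\Rightarrow f(x)\le f(y)$; homogeneous: $f(tx)=tf(x)$ for $t>0$. Multiplicatively convex: each entry of $\log\circ f\circ\exp$ is convex. Real analytic: each entry of $f$ is real analytic on $\mathbb{R}^n_{>0}$. $d_H(x,y)=\log\max_{i,j}\frac{y_ix_j}{x_iy_j}$; $E(f)=\{x\in\mathbb{R}^n_{>0}:f(x)=\mu x \text{ for some }\mu\}$. $f$ extends continuously to an order-preserving homogeneous map on $\mathbb{R}^n_{\ge0}$, also denoted $f$. $P^J_0(x)_j=x_j$ for $j\in J$, $0$ otherwise; $f^J_0=P^J_0fP^J_0$. $r(g)=\inf_{x\in\mathbb{R}^n_{>0}}\max_ig(x)_i/x_i$. $\mathcal{G}(f)$ is the directed graph on $[n]$ with an arc $i\to j$ when $\lim_{t\to\infty}f(\exp(te_{\{j\}}))_i=\infty$. A final class is a strongly connected component of $\mathcal{G}(f)$ with no arcs leaving it. $f$ is strongly nonnegative if $r(f^C_0)=r(f)$ for every final class $C$ and $r(f^C_0)<r(f)$ for every strongly connected component $C$ that is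 not a final class. *)

(* Defs.v *)
From HB Require Import structures.
From mathcomp Require Import all_boot all_order all_algebra.
From mathcomp Require Import all_classical all_reals all_analysis.
Set Implicit Arguments. Unset Strict Implicit. Unset Printing Implicit Defensive.
Import Order.TTheory GRing.Theory Num.Theory numFieldNormedType.Exports.
Local Open Scope classical_set_scope.
Local Open Scope ring_scope.

Section Defs.
Variables (R : realType) (n : nat).

Definition vec := 'I_n -> R.

Definition pos (x : vec) : Prop := forall i, 0 < x i.
Definition nonneg (x : vec) : Prop := forall i, 0 <= x i.
Definition vle (x y : vec) : Prop := forall i, x i <= y i.
Definition vscale (t : R) (x : vec) : vec := fun i => t * x i.

(* f : R^n_{>0} -> R^n_{>0}, represented by a total map; only its values on
   the positive orthant matter below. *)
Definition maps_pos (f : vec -> vec) : Prop := forall x, pos x -> pos (f x).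

Definition order_preserving (f : vec -> vec) : Prop :=
  forall x y, pos x -> pos y -> vle x y -> vle (f x) (f y).

Definition homogeneous (f : vec -> vec) : Prop :=
  forall x t, pos x -> 0 < t -> f (vscale t x) = vscale t (f x).

Definition vexp (u : vec) : vec := fun i => expR (u i).

Definition convex_fun (g : vec -> R) : Prop :=
  forall u v (l : R), 0 <= l -> l <= 1 ->
    g (fun k => l * u k + (1 - l) * v k) <= l * g u + (1 - l) * g v.

Definition mult_convex (f : vec -> vec) : Prop :=
  forall i, convex_fun (fun u => ln (f (vexp u) i)).

Definition dH (x y : vec) : R :=
  ln (\big[Num.max/0]_(i < n) \big[Num.max/0]_(j < n) (y i * x j / (x i * y j))).

Definition dH_bounded (A : set vec) : Prop :=
  exists M : R, forall x y, A x -> A y -> dH x y <= M.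

Definition eigvecs (f : vec -> vec) : set vec :=
  [set x | pos x /\ exists mu : R, f x = vscale mu x].

(* the continuous extension of f to R^n_{>=0}:
   f(x) = lim_{t -> 0+} f(x + t 1) = inf_{t>0} f(x + t 1) (entrywise) *)
Definition ext (f : vec -> vec) (x : vec) : vec :=
  fun i => inf [set f (fun k => x k + t) i | t in [set t : R | 0 < t]].

Definition proj0 (J : {set 'I_n}) (x : vec) : vec :=
  fun j => if j \in J then x j else 0.

Definition fJ0 (f : vec -> vec) (J : {set 'I_n}) : vec -> vec :=
  fun x => proj0 J (ext f (proj0 J x)).

Definition cw_radius (g : vec -> vec) : R :=
  inf [set \big[Num.max/0]_(i < n) (g x i / x i) | x in pos].

Definition exp_te (j : 'I_n) (t : R) : vec :=
  fun k => if k == j then expR t else 1.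

Definition arc (f : vec -> vec) (i j : 'I_n) : Prop :=
  forall M : R, exists T : R, forall t, T <= t -> M <= f (exp_te j t) i.

Definition graph_rel (f : vec -> vec) : rel 'I_n :=
  fun i j => `[< arc f i j >].

Definition scc (f : vec -> vec) (C : {set 'I_n}) : Prop :=
  exists i, C = finset (fun j => connect (graph_rel f) i j && connect (graph_rel f) j i).

Definition final_class (f : vec -> vec) (C : {set 'I_n}) : Prop :=
  scc f C /\ forall i j, i \in C -> graph_rel f i j -> j \in C.

Definition strongly_nonneg (f : vec -> vec) : Prop :=
  (forall C, final_class f C -> cw_radius (fJ0 f C) = cw_radius f) /\
  (forall C, scc f C -> ~ final_class f C -> cw_radius (fJ0 f C) < cw_radius f).

Definition unique_final_class (f : vec -> vec) : Prop :=
  exists C, final_class f C /\ forall C', final_class f C' -> C' = C.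

(* real analyticity at x of g : R^n_{>0} -> R: near x, g is the sum of an
   absolutely convergent power series centered at x (cube partial sums). *)
Definition ps_term (a : ('I_n -> nat) -> R) (x y : vec) (al : 'I_n -> nat) : R :=
  a al * \prod_(k < n) (y k - x k) ^+ (al k).

Definition ps_partial (F : ('I_n -> nat) -> R) (N : nat) : R :=
  \sum_(al : {ffun 'I_n -> 'I_N.+1}) F (fun k => nat_of_ord (al k)).

Definition real_analytic_at (g : vec -> R) (x : vec) : Prop :=
  exists2 d : R, 0 < d & exists a : ('I_n -> nat) -> R,
    forall y, pos y -> (forall k, `|y k - x k| < d) ->
      (exists B : R, forall N, ps_partial (fun al => `|ps_term a x y al|) N <= B) /\
      (ps_partial (ps_term a x y) @ \oo --> g y).

Definition real_analytic (f : vec -> vec) : Prop :=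
  forall i x, pos x -> real_analytic_at (fun y => f y i) x.

End Defs.

(* Main.v *)
(* In logarithmic coordinates, T u = ln f(exp u) - ln r(f) is monotone and commutes
   with adding constants, and eigenvectors of f are fixed points of T.  Convexity is
   used only to see that (T u)_i depends on u_j exactly when i -> j is an arc.  For a
   class C, r(f^C_0) < r(f) means that T w < w on C for some w.  If there is no such w,
   the orbit of a supersolution (T z <= z) never decreases at some point of C: otherwise
   an entrywise minimum of time-tilted iterates of z would be such a w.
   Existence: a supersolution is glued from the classes, stacked so that upstream classes
   are much higher; its orbit does not decrease at some point of each final class,
   hence is bounded below, since its minimal entries lead to a final class.
   Conversely, given a fixed point v and a class C with r(f^C_0) >= r(f), raise v by s
   on the indices leading to C; the orbit converges to a fixed point u with u_c = v_c + s
   for some c in C and u = v off those indices, so E(f) is unbounded unless every index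
   leads to C.  In the analytic case f_i is constant on the segment from exp u to
   exp (v + s) when u_i = v_i + s, hence on the whole ray, so the set of such i is closed
   under arcs, which is absurd. *)
Require Import Defs.
From HB Require Import structures.
From mathcomp Require Import all_boot all_order all_algebra.
From mathcomp Require Import all_classical all_reals all_analysis.
From mathcomp Require Import ring lra.
Set Implicit Arguments.
Unset Strict Implicit.
Unset Printing Implicit Defensive.
Import Order.TTheory GRing.Theory Num.Theory.
Local Open Scope classical_set_scope.
Local Open Scope ring_scope.

(** * Bounds, extrema and gaps over finite index types *)

Section FiniteFamilies.
Variables (R : realType) (I : finType).

Lemma fin_uniform_bound (P : I -> R -> Prop) :
  (forall i a b, a <= b -> P i a -> P i b) ->
  (forall i, exists a, P i a) -> exists a, forall i, P i a.
Proof.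
move=> Pmono /choice[g Pg]; exists (\big[Num.max/0]_i g i) => i.
exact: Pmono (le_bigmax_cond _ _ _) (Pg i).
Qed.

Lemma fin_ubound (u : I -> R) : exists a, forall i, u i <= a.
Proof.
apply: (@fin_uniform_bound (fun i a => u i <= a)) => [i a b ab ua|i].
  exact: le_trans ua ab.
by exists (u i).
Qed.

Lemma fin_lbound (u : I -> R) : exists a, forall i, a <= u i.
Proof.
by have [a ua] := fin_ubound (fun i => - u i); exists (- a) => i; rewrite lerNl.
Qed.

Lemma fin_argmin (D : {set I}) (u : I -> R) i0 : i0 \in D ->
  exists2 i, i \in D & forall j, j \in D -> u i <= u j.
Proof. by move=> /(arg_minP u)[i iD umin]; exists i. Qed.

Lemma fin_argmax (D : {set I}) (u : I -> R) i0 : i0 \in D ->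
  exists2 i, i \in D & forall j, j \in D -> u j <= u i.
Proof. by move=> /(arg_maxP u)[i iD umin]; exists i. Qed.

Lemma fin_gap (D : {set I}) (u v : I -> R) :
  (forall i, i \in D -> u i < v i) ->
  exists2 d, 0 < d & forall i, i \in D -> u i + d <= v i.
Proof.
move=> uv; have [->|[i0 i0D]] := set_0Vmem D.
  by exists 1 => // i; rewrite inE.
have [i iD imin] := fin_argmin (fun i => v i - u i) i0D.
exists (v i - u i) => [|j jD]; first by rewrite subr_gt0 uv.
by have := imin j jD; lra.
Qed.

End FiniteFamilies.

(** * Strongly connected classes of a finite relation *)

Section Classes.
Variables (I : finType) (e : rel I).

(** For [e := graph_rel f] this is the set in [scc]; [closed_set] is the extra condition in
    [final_class]. *)
Definition class_of (i : I) : {set I} :=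
  finset (fun j => connect e i j && connect e j i).

Definition closed_set (D : {set I}) := forall i j, i \in D -> e i j -> j \in D.

Definition reach (i : I) : {set I} := finset (connect e i).

Lemma class_of_refl i : i \in class_of i.
Proof. by rewrite inE connect0. Qed.

Lemma class_of_eq i j : j \in class_of i -> class_of j = class_of i.
Proof.
rewrite inE => /andP[ij ji]; apply/setP => k; rewrite !inE.
by apply/andP/andP => -[a b]; split; apply: connect_trans; eauto.
Qed.

Lemma closed_set_connect D i j : closed_set D -> i \in D -> connect e i j -> j \in D.
Proof.
move=> Dcl iD /connectP[p + ->]; elim: p i iD => //= k p IH i iD /andP[ik kp].
exact: IH (Dcl _ _ iD ik) kp.
Qed.

Lemma card_reach_class i j : j \in class_of i -> #|reach j| = #|reach i|.
Proof.
rewrite inE => /andP[ij ji].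
by apply: eq_card => m; rewrite !inE; apply/idP/idP; exact: connect_trans.
Qed.

(** The size of the reachable set serves as a rank on classes: after an arc that leaves the class,
    [i] is no longer reachable. *)
Lemma card_reach_arc i j : e i j -> j \notin class_of i ->
  (#|reach j| < #|reach i|)%N.
Proof.
move=> ij; rewrite inE (connect1 ij) /= => ji; apply: proper_card.
apply/properP; split.
  by apply/fintype.subsetP => k; rewrite !inE; apply/connect_trans/connect1.
by exists i; rewrite inE ?connect0.
Qed.

(** Take a reachable vertex of least rank: an arc out of its class would lower the rank. *)
Lemma connect_closed_class i :
  exists2 j, connect e i j & closed_set (class_of j).
Proof.
have iP : i \in reach i by rewrite inE connect0.
have [j + jmin] : exists2 j, j \in reach i &
    forall k, k \in reach i -> (#|reach j| <= #|reach k|)%N.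
  by have [j jP jmin] := arg_minP (fun j => #|reach j|) iP; exists j.
rewrite inE => ij; exists j => // k l kj kl; apply: contraT => lj.
have := card_reach_arc kl; rewrite (class_of_eq kj) => /(_ lj).
have jk : connect e j k by move: kj; rewrite inE => /andP[].
have il : l \in reach i.
  by rewrite inE (connect_trans ij) // (connect_trans jk) // connect1.
have jl := jmin l il.
by rewrite (card_reach_class kj) ltnNge jl.
Qed.

End Classes.

(** * Monotone additively homogeneous maps *)

Section Topical.
Variables (R : realType) (n : nat) (T : vec R n -> vec R n) (e : rel 'I_n).

(** Only successors of [i] are compared, so [T u i] depends on no other coordinate. *)
Definition monotone_along := forall i u v,
  (forall j, e i j -> u j <= v j) -> T u i <= T v i.

Definition additively_homogeneous := forall u t i, T (fun j => u j + t) i = T u i + t.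

Definition coercive_along := forall i j, e i j -> forall M, exists B, forall t,
  B <= t -> M <= T (fun k => if k == j then t else 0) i.

Definition contracts (C : {set 'I_n}) := exists w, forall i, i \in C -> T w i < w i.

Hypotheses (Tmono : monotone_along) (Thom : additively_homogeneous).

Lemma topical_shift i u v t :
  (forall j, e i j -> u j <= v j + t) -> T u i <= T v i + t.
Proof. by rewrite -Thom; apply: Tmono. Qed.

Lemma iter_le N u v : (forall i, u i <= v i) -> forall i, iter N T u i <= iter N T v i.
Proof. by move=> uv; elim: N => // N IH i; apply: Tmono => j _; apply: IH. Qed.

Lemma iter_super_noninc z N M i : (forall i, T z i <= z i) -> (N <= M)%N ->
  iter M T z i <= iter N T z i.
Proof.
move=> Tz NM; rewrite -(subnK NM); elim: (M - N)%N => // k IH.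
by apply: le_trans IH; rewrite addSn iterSr; apply: iter_le.
Qed.

(** Maximum principle: compare [T v] and [T w] at an index of [D] where [v - w] is largest; its
    successors stay in [D]. *)
Lemma le_of_contracting (D : {set 'I_n}) i0 v w : closed_set e D -> i0 \in D ->
  (forall i, i \in D -> v i <= T v i) -> ~ (forall i, i \in D -> T w i < w i).
Proof.
move=> Dcl i0D vT Tw; have [i iD imax] := fin_argmax (fun i => v i - w i) i0D.
have : T v i <= T w i + (v i - w i).
  by apply: topical_shift => j ij; have := imax j (Dcl _ _ iD ij); lra.
by have := vT i iD; have := Tw i iD; lra.
Qed.

(** The orbit decreases to its infimum. A uniform error [eps] passes unchanged through [T], which
    does the work of continuity. *)
Lemma iter_super_limit z : (forall i, T z i <= z i) ->
  (forall i, exists L, forall N, L <= iter N T z i) ->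
  exists u, [/\ forall i, T u i = u i, forall N i, u i <= iter N T z i
    & forall i c, (forall N, c <= iter N T z i) -> c <= u i].
Proof.
move=> Tz bnd; pose S i := range (fun N => iter N T z i).
have S0 i : S i !=set0 by exists (z i), 0%N.
have Slb i : has_lbound (S i).
  by have [L LT] := bnd i; exists L => _ [N _ <-].
pose u := (fun i => inf (S i)) : vec R n.
have uN N i : u i <= iter N T z i by apply: ge_inf => //; exists N.
have uc i c : (forall N, c <= iter N T z i) -> c <= u i.
  by move=> cN; apply: lb_le_inf => // _ [N _ <-].
exists u; split => // i; apply/eqP; rewrite eq_le; apply/andP; split.
  apply: uc => -[|N] /=; last by apply: Tmono => j _; apply: uN.
  by apply: le_trans (Tz i); apply: Tmono => j _; apply: (uN 0%N).
apply/ler_addgt0Pr => eps eps0.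
have [N NP] : exists N, forall j, iter N T z j <= u j + eps.
  have /choice[N NP] : forall j, exists N, iter N T z j <= u j + eps.
    move=> j; have [_ [N _ <-] H] := inf_adherent eps0 (conj (S0 j) (Slb j)).
    by exists N; apply: ltW.
  exists (\max_j N j)%N => j; apply: le_trans (NP j).
  by apply: iter_super_noninc => //; apply: leq_bigmax.
apply: le_trans (uN N.+1 i) _; apply: topical_shift => j _; exact: NP.
Qed.

(* The entrywise minimum of the orbit of [z], tilted linearly in time. *)
Lemma contracts_of_iter (C : {set 'I_n}) z N :
  (forall i, i \in C -> iter N T z i < z i) -> contracts C.
Proof.
case: N => [|N] NC.
  by exists z => i /NC; rewrite /= ltxx.
(* A total tilt of [N * eps] stays below the drop [d], so the bound at [k = N] puts [T w] below [z].
   The later entries of the minimum are beaten by [eps], using the bound at the preceding [k]. *)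
have [d d0 dC] := fin_gap NC; pose eps := d / N.+1%:R.
have eps0 : 0 < eps by rewrite divr_gt0.
have epsN : N%:R * eps < d.
  by rewrite /eps mulrCA gtr_pMr // ltr_pdivrMr // mul1r ltr_nat.
pose w : vec R n := fun j => \big[Num.min/z j]_(k < N.+1) (iter k T z j + k%:R * eps).
have Tw i (k : 'I_N.+1) : T w i <= iter k.+1 T z i + k%:R * eps.
  by apply: topical_shift => j _; exact: bigmin_le.
exists w => i iC; have Twz : T w i < z i.
  by have := Tw i ord_max; have := dC i iC; rewrite /=; lra.
apply/bigmin_gtP; split => // -[[|k] kN] _ /=; first by rewrite mul0r addr0.
apply: le_lt_trans (Tw i (Ordinal (ltnW kN))) _ => /=.
by rewrite ltrD2l ltr_pM2r // ltr_nat.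
Qed.

(** Otherwise every index of [C] drops at some time; as the orbit is nonincreasing, the largest of
    these times serves them all. *)
Lemma super_stationary (C : {set 'I_n}) z : (forall i, T z i <= z i) -> ~ contracts C ->
  exists2 c, c \in C & forall N, z c <= iter N T z c.
Proof.
move=> Tz nC; apply: contrapT => H; apply: nC.
have /choice[N NP] : forall c, exists N, c \in C -> iter N T z c < z c.
  move=> c; apply: contrapT => cN; apply: H; exists c.
    by apply: contrapT => /negP cC; apply: cN; exists 0%N => /(negP cC).
  by move=> N; rewrite leNgt; apply/negP => h; apply: cN; exists N.
apply: (@contracts_of_iter C z (\max_c N c)) => c cC; apply: le_lt_trans (NP c cC).
by apply: iter_super_noninc => //; apply: leq_bigmax.
Qed.

(* Raising a fixed point [v] by [s] upstream of [C] gives a supersolution,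
   whose orbit converges to the new fixed point. *)
Lemma fixed_point_raise (C : {set 'I_n}) v s : (forall i, T v i = v i) -> ~ contracts C -> 0 <= s ->
  exists u c, [/\ forall i, T u i = u i, c \in C, u c = v c + s,
    forall j, u j <= v j + s
    & forall j, ~~ [exists c in C, connect e j c] -> u j = v j].
Proof.
move=> Tv nC s0; pose U j := [exists c in C, connect e j c].
pose z : vec R n := fun j => v j + (if U j then s else 0).
have vz j : v j <= z j by rewrite /z; case: ifP => _; lra.
have zs j : z j <= v j + s by rewrite /z; case: ifP => _; lra.
have Tz i : T z i <= z i.
  have [Ui|nUi] := boolP (U i).
    by rewrite {2}/z Ui -(Tv i); apply: topical_shift => j _.
  rewrite {2}/z (negbTE nUi) addr0 -(Tv i); apply: Tmono => j ij.
  suff nUj : ~~ U j by rewrite /z (negbTE nUj) addr0.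
  apply: contra nUi => /existsP[c /andP[cC jc]]; apply/existsP; exists c.
  by rewrite cC (connect_trans (connect1 ij)).
have viter N i : v i <= iter N T z i.
  elim: N i => // N IH i /=; rewrite -{1}(Tv i); exact: Tmono.
have [|u [Tu uN uc]] := iter_super_limit Tz; first by move=> i; exists (v i).
have [c cC zc] := super_stationary Tz nC.
have [d dC dc] : exists2 d, d \in C & forall N, z d <= iter N T z d by exists c.
have Ud : U d by apply/existsP; exists d; rewrite dC connect0.
exists u, d; split => //.
- apply/eqP; rewrite eq_le; apply/andP; split; first exact: le_trans (uN 0%N d) _.
  by have := uc d _ dc; rewrite /z Ud.
- by move=> j; apply: le_trans (uN 0%N j) _.
- move=> j nUj; apply/eqP; rewrite eq_le uc // andbT; apply: le_trans (uN 0%N j) _.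
  by rewrite /= /z (negbTE (nUj : ~~ U j)) addr0.
Qed.

Hypothesis Tcoer : coercive_along.

(** Induction along the path: a successor far above the floor [m] would, by coercivity, push [T u i]
    above [u i + mu]. The constant is chosen before [D], [u] and [m], so it is uniform over
    orbits. *)
Lemma connect_bound i j mu : connect e i j -> forall K, exists K', forall (D : {set 'I_n}) u m,
  closed_set e D -> (forall k, k \in D -> T u k <= u k + mu) ->
  (forall k, k \in D -> m <= u k) -> i \in D -> u i <= m + K -> u j <= m + K'.
Proof.
move=> /connectP[p + ->]; elim: p i => [|k p IH] i /=; first by move=> _ K; exists K.
move=> /andP[ik kp] K; have [B BP] := Tcoer ik (K + mu + 1).
have [K' K'P] := IH k kp B; exists K' => D u m Dcl Tu mu' iD ui.
apply: (K'P D) => //; first exact: Dcl ik.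
rewrite leNgt; apply/negP => mB.
have /BP h : B <= u k - m by lra.
have : T (fun l => if l == k then u k - m else 0) i <= T u i + - m.
  apply: topical_shift => l il; case: eqP => [->//|_].
  by have := mu' l (Dcl _ _ iD il); lra.
by have := Tu i iD; lra.
Qed.

Lemma connect_argmin_bound mu : exists B, forall (D : {set 'I_n}) u i j,
  closed_set e D -> (forall k, k \in D -> T u k <= u k + mu) ->
  i \in D -> (forall k, k \in D -> u i <= u k) -> connect e i j -> u j <= u i + B.
Proof.
have [|ij|B BP] := @fin_uniform_bound R ('I_n * 'I_n)%type (fun ij B =>
  connect e ij.1 ij.2 -> forall (D : {set 'I_n}) u,
  closed_set e D -> (forall k, k \in D -> T u k <= u k + mu) ->
  ij.1 \in D -> (forall k, k \in D -> u ij.1 <= u k) -> u ij.2 <= u ij.1 + B).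
- move=> ij a b ab H c D u h1 h2 h3 h4; apply: le_trans (H c D u h1 h2 h3 h4) _.
  by rewrite lerD2l.
- have [c|nc] := boolP (connect e ij.1 ij.2); last by exists 0.
  have [K KP] := connect_bound mu c 0; exists K => _ D u Dcl Tu iD imin.
  by apply: (KP D) => //; rewrite addr0.
- by exists B => D u i j Dcl Tu iD imin c; exact: (BP (i, j) c D).
Qed.

(** The smallest entry of an iterate leads to a closed class, hence to an index that has not
    dropped; [connect_argmin_bound] carries this lower bound back to it. *)
Lemma fixed_point_exists z : (forall i, T z i <= z i) ->
  (forall i, closed_set e (class_of e i) -> ~ contracts (class_of e i)) ->
  exists u, forall i, T u i = u i.
Proof.
move=> Tz nC; have [B BP] := connect_argmin_bound 0.
have [a az] := fin_lbound z.
have [|u [Tu _ _]] := iter_super_limit Tz; last by exists u.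
move=> i0; exists (a - B) => N.
have [i _ imin] := fin_argmin (iter N T z) (finset.in_setT i0).
apply: le_trans (imin i0 (finset.in_setT i0)).
have [j ij jcl] := connect_closed_class e i.
have [c cC /(_ N) zc] := super_stationary Tz (nC j jcl).
have ic : connect e i c.
  by apply: connect_trans ij _; move: cC; rewrite inE => /andP[].
have : iter N T z c <= iter N T z i + B.
  apply: (BP (finset.setTfor 'I_n)); rewrite ?finset.in_setT //.
  by move=> k _; rewrite addr0; apply: (iter_super_noninc k Tz (leqnSn N)).
by have := az c; lra.
Qed.

(** By strictness elsewhere, [u - z] peaks in the class of [i0]; the smallest entry of [u] leads to
    that peak, which limits its height. *)
Lemma fixed_points_bounded z i0 : (forall i, T z i <= z i) ->
  (forall i, i \notin class_of e i0 -> T z i < z i) ->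
  (forall i, connect e i i0) ->
  exists M, forall u, (forall i, T u i = u i) -> forall i j, u i <= u j + M.
Proof.
move=> Tz Tz' ci0; have [B BP] := connect_argmin_bound 0.
have [a az] := fin_lbound z; have [b bz] := fin_ubound z.
exists (b - a + B) => u Tu i j.
have [k _ kmin] := fin_argmin u (finset.in_setT i).
have [l _ lmax] := fin_argmax (fun i => u i - z i) (finset.in_setT i).
have lC : l \in class_of e i0.
  apply: contraT => /Tz' Tzl.
  have : T u l <= T z l + (u l - z l).
    by apply: topical_shift => m _; have := lmax m (finset.in_setT m); lra.
  by rewrite Tu; lra.
have : u l <= u k + B.
  apply: (BP (finset.setTfor 'I_n)); rewrite ?finset.in_setT //.
  - by move=> p _; rewrite Tu addr0.
  - by apply: connect_trans (ci0 k) _; move: lC; rewrite inE => /andP[].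
have := lmax i (finset.in_setT i); have := kmin j (finset.in_setT j).
by have := az l; have := bz i; lra.
Qed.

(** Approximate supersolutions, normalised at [i0], are bounded on the class by coercivity. Their
    entrywise lower limit is a supersolution, since [T] of an infimum is at most the infimum of the
    images. *)
Lemma super_attained i0 : closed_set e (class_of e i0) ->
  (forall eps, 0 < eps -> exists w, forall i, i \in class_of e i0 -> T w i <= w i + eps) ->
  exists w, forall i, i \in class_of e i0 -> T w i <= w i.
Proof.
set C := class_of e i0 => Ccl Ceps; have i0C : i0 \in C := class_of_refl e i0.
(* The slack 1 covers every tolerance [1 / (k + 1)] used below. *)
have [B BP] := connect_argmin_bound 1.
have Ccon i j : i \in C -> j \in C -> connect e i j.
  by rewrite !inE => /andP[_ a] /andP[b _]; apply: connect_trans b.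
have /choice[u uP] (k : nat) : exists u : vec R n,
    (forall i, i \in C -> T u i <= u i + k.+1%:R^-1) /\
    (forall i, i \in C -> - B <= u i <= B).
  have [|w Tw] := Ceps k.+1%:R^-1; first by rewrite invr_gt0.
  exists (fun j => w j + - w i0); split=> [i iC|].
    by rewrite Thom addrAC lerD2r; apply: Tw.
  have Tw1 i : i \in C -> T w i <= w i + 1.
    move=> iC; apply: le_trans (Tw i iC) _; rewrite lerD2l invf_le1 ?ltr0n //.
    by rewrite ler1n.
  have [m mC mmin] := fin_argmin w i0C.
  move=> i iC /=; have := BP C w m i Ccl Tw1 mC mmin (Ccon _ _ mC iC).
  have := BP C w m i0 Ccl Tw1 mC mmin (Ccon _ _ mC i0C).
  by have := mmin i iC; have := mmin i0 i0C; lra.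
pose S k j := [set u l j | l in [set l | (k <= l)%N]].
have S0 k j : S k j !=set0 by exists (u k j), k => /=.
have Slb k j : j \in C -> lbound (S k j) (- B).
  by move=> jC _ [l _ <-]; have /andP[] := (uP l).2 j jC.
pose a k := (fun j => inf (S k j)) : vec R n.
have au k l j : j \in C -> (k <= l)%N -> a k j <= u l j.
  by move=> jC kl; apply: ge_inf; [exists (- B); apply: Slb|exists l].
have aub k j : j \in C -> a k j <= B.
  by move=> jC; apply: le_trans (au k k j jC (leqnn k)) _; have /andP[] := (uP k).2 j jC.
have Ta k i : i \in C -> T (a k) i <= a k i + k.+1%:R^-1.
  move=> iC; rewrite -lerBlDr; apply: lb_le_inf => // _ [l kl <-].
  rewrite lerBlDr; have : T (a k) i <= T (u l) i.
    by apply: Tmono => j ij; apply: au => //; apply: Ccl ij.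
  move=> /le_trans; apply; apply: le_trans ((uP l).1 i iC) _.
  by rewrite lerD2l lef_pV2 ?posrE ?ltr0n // ler_nat.
have amono k l j : j \in C -> (k <= l)%N -> a k j <= a l j.
  move=> jC kl; apply: lb_le_inf => // _ [m /= lm <-]; apply: au => //.
  exact: leq_trans lm.
pose w := (fun j => sup (range (fun k => a k j))) : vec R n.
have wub j : j \in C -> has_sup (range (fun k => a k j)).
  by move=> jC; split; [exists (a 0%N j), 0%N|exists B => _ [k _ <-]; apply: aub].
exists w => i iC; apply/ler_addgt0Pr => eps eps0.
have d0 : 0 < eps / 2 by rewrite divr_gt0.
have /choice[N NP] : forall j, exists N, j \in C -> w j - eps / 2 < a N j.
  move=> j; have [jC|_] := boolP (j \in C); last by exists 0%N.
  by have [_ [N _ <-] aN] := sup_adherent d0 (wub j jC); exists N.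
have [M MP] : exists M : nat, M.+1%:R^-1 < eps / 2.
  exists (Num.truncn (eps / 2)^-1); rewrite -ltf_pV2 ?posrE ?invr_gt0 ?ltr0n // invrK.
  exact: truncnS_gt.
pose k := maxn M (\max_j N j); have Twa : T w i <= T (a k) i + eps / 2.
  apply: topical_shift => j ij; have jC := Ccl _ _ iC ij.
  have := NP j jC; suff : a (N j) j <= a k j by lra.
  by apply: amono => //; rewrite leq_max leq_bigmax orbT.
have kM : k.+1%:R^-1 <= M.+1%:R^-1 :> R.
  by rewrite lef_pV2 ?posrE ?ltr0n // ler_nat ltnS leq_maxl.
have : a k i <= w i by apply: sup_upper_bound; [exact: wub|exists k].
have := Ta k i iC; move: kM MP Twa.
by move: (k.+1%:R^-1 : R) (M.+1%:R^-1 : R) => p q; lra.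
Qed.

(** The logarithmic form of [proj0 C], with the zero entries replaced by [exp (- K)]. *)
Definition cutoff (C : {set 'I_n}) (w : vec R n) K : vec R n :=
  fun j => if j \in C then w j else - K.

Lemma cutoff_in (C : {set 'I_n}) w K i : i \in C -> cutoff C w K i = w i.
Proof. by rewrite /cutoff => ->. Qed.

(* Lift the class of [i] to height [s * #|reach i|]: for [s] large, all the
   classes downstream of it are then below its cutting level. *)
Lemma super_glue :
  (forall i, let C := class_of e i in exists w K, forall j, j \in C ->
    T (cutoff C w K) j <= w j /\ (~ closed_set e C -> T (cutoff C w K) j < w j)) ->
  exists z, forall i, T z i <= z i /\ (~ closed_set e (class_of e i) -> T z i < z i).
Proof.
move=> H.
have /choice[w /choice[K wK]] : forall C, exists w K, forall i, C = class_of e i ->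
    forall j, j \in C ->
    T (cutoff C w K) j <= w j /\ (~ closed_set e C -> T (cutoff C w K) j < w j).
  move=> C; have [[i ->]|nC] := pselect (exists i, C = class_of e i).
    by have [w [K wK]] := H i; exists w, K.
  by exists (fun=> 0), 0 => i Ci; case: nC; exists i.
have [W WP] := fin_ubound (fun ij => w (class_of e ij.1) ij.2).
have [L LP] := fin_ubound (fun i => K (class_of e i)).
(* Leaving a class lowers the rank by at least 1, so the level drops by at least [W + L]: enough to
   pass from any [w] to below any [- K]. *)
pose s := Num.max 0 (W + L).
have s0 : 0 <= s by rewrite le_max lexx.
have sWL : W + L <= s by rewrite le_max lexx orbT.
pose h i : R := #|reach e i|%:R.
pose z : vec R n := fun i => w (class_of e i) i + s * h i.
exists z => i; set C := class_of e i.
have : T z i <= T (cutoff C (w C) (K C)) i + s * h i.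
  apply: topical_shift => j ij; rewrite /z /cutoff.
  have [jC|jC] := boolP (j \in C).
    by rewrite (class_of_eq jC) /h (card_reach_class jC).
  have hij : h j + 1 <= h i.
    by rewrite /h natr1 ler_nat; apply: card_reach_arc.
  have := ler_wpM2l s0 hij; rewrite mulrDr mulr1.
  by have := WP (j, j); have := LP i; rewrite /= -/C; lra.
have [le lt] := wK C i erefl i (class_of_refl e i).
rewrite -[z i]/(w C i + s * h i) => Tzi; split; first by lra.
by move=> /lt; lra.
Qed.

End Topical.

(** * Collatz-Wielandt numbers in logarithmic coordinates *)

Section CollatzWielandt.
Variables (R : realType) (n : nat) (g : vec R n -> vec R n) (mu : R).

Let ratio (x : vec R n) := \big[Num.max/0]_(i < n) (g x i / x i).

Let ratio_lbound : has_lbound [set ratio x | x in @pos R n].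
Proof. by exists 0 => _ [x _ <-]; apply: bigmax_ge_id. Qed.

Lemma cw_radius_lt_witness : cw_radius g < mu ->
  exists2 x, pos x & forall i, g x i < mu * x i.
Proof.
move=> gmu; have H : has_inf [set ratio x | x in @pos R n].
  by split => //; exists (ratio (fun=> 1)), (fun=> 1) => // i; apply: ltr01.
have eps0 : 0 < mu - cw_radius g by rewrite subr_gt0.
have [_ [x xpos <-]] := inf_adherent eps0 H.
rewrite [X in _ < X]addrC subrK => /bigmax_ltP[_ xmu]; exists x => // i.
by rewrite -ltr_pdivrMr //; apply: xmu.
Qed.

Lemma cw_radius_lt x : 0 < mu -> pos x -> (forall i, g x i < mu * x i) ->
  cw_radius g < mu.
Proof.
move=> mu0 xpos gx; apply: (@le_lt_trans _ _ (ratio x)).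
  by apply: ge_inf => //; exists x.
by apply/bigmax_ltP; split => // i _; rewrite ltr_pdivrMr.
Qed.

End CollatzWielandt.

(** * The map [f] in logarithmic coordinates *)

Section LogCoordinates.
Variables (R : realType) (n : nat) (f : vec R n -> vec R n).
Hypotheses (fpos : maps_pos f) (fmono : order_preserving f) (fhom : homogeneous f).

Definition log_map lam : vec R n -> vec R n := fun u i => ln (f (vexp u) i) - lam.

Definition vln (x : vec R n) : vec R n := fun i => ln (x i).

Lemma vexp_pos (u : vec R n) : pos (vexp u).
Proof. by move=> i; apply: expR_gt0. Qed.

Lemma vlnK x : pos x -> vexp (vln x) = x.
Proof. by move=> xpos; apply/funext => i; rewrite /vexp lnK // posrE. Qed.

Lemma expR_log_map lam u i : expR (log_map lam u i + lam) = f (vexp u) i.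
Proof. by rewrite subrK lnK // posrE; apply: fpos (vexp_pos u) i. Qed.

Lemma log_map_le lam u v : (forall j, u j <= v j) ->
  forall i, log_map lam u i <= log_map lam v i.
Proof.
move=> uv i; rewrite lerD2r ler_ln ?posrE ?(fpos (vexp_pos _)) //.
by apply: fmono => [||j]; [exact: vexp_pos..|rewrite /vexp ler_expR].
Qed.

Lemma log_map_lt lam w i y :
  (log_map lam w i < y) = (f (vexp w) i < expR lam * expR y).
Proof. by rewrite -(expR_log_map lam) -expRD ltr_expR addrC ltrD2l. Qed.

Lemma log_map_homogeneous lam : additively_homogeneous (log_map lam).
Proof.
move=> u t i; rewrite /log_map.
have -> : vexp (fun j => u j + t) = vscale (expR t) (vexp u).
  by apply/funext => j; rewrite /vscale /vexp expRD mulrC.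
rewrite fhom ?expR_gt0 //; last exact: vexp_pos.
rewrite /vscale lnM ?posrE ?expR_gt0 ?(fpos (vexp_pos _)) // expRK.
by rewrite -addrA addrC.
Qed.

Lemma log_map_coercive lam : coercive_along (log_map lam) (graph_rel f).
Proof.
move=> i j /asboolP ij M; have [B BP] := ij (expR (M + lam)).
exists B => t /BP; have -> : exp_te j t = vexp (fun k => if k == j then t else 0).
  by apply/funext => k; rewrite /exp_te /vexp; case: ifP; rewrite ?expR0.
by rewrite -(expR_log_map lam) ler_expR lerD2r.
Qed.

Section Convexity.
Hypothesis fconv : mult_convex f.

(* A convex function that is bounded above on a half-line is nonincreasing. *)
Lemma log_map_no_arc lam i j : ~~ graph_rel f i j -> forall u t, 0 <= t ->
  log_map lam (fun k => u k + (if k == j then t else 0)) i <= log_map lam u i.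
Proof.
move=> /asboolPn narc u t t0.
pose b s : vec R n := fun k => if k == j then s else 0.
(* If the values on this ray were unbounded, monotonicity would make them tend to infinity, giving
   an arc. [Num.max 1 M] keeps the argument of [ln] positive. *)
have [K KP] : exists K, forall s, log_map lam (b s) i <= K.
  apply: contrapT => nK; apply: narc => M.
  have [s sM] : exists s, ln (Num.max 1 M) - lam < log_map lam (b s) i.
    apply: contrapT => ns; apply: nK; exists (ln (Num.max 1 M) - lam) => s.
    by rewrite leNgt; apply/negP => h; apply: ns; exists s.
  exists s => s' ss'; have : log_map lam (b s) i <= log_map lam (b s') i.
    by apply: log_map_le => k; rewrite /b; case: ifP.
  move=> /(lt_le_trans sM); rewrite ltrD2r => h.
  have -> : exp_te j s' = vexp (b s').
    by apply/funext => k; rewrite /exp_te /vexp /b; case: ifP; rewrite ?expR0.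
  have Mpos : 0 < Num.max 1 M by rewrite lt_max ltr01.
  move: h; rewrite ltr_ln ?posrE ?(fpos (vexp_pos _)) // => /ltW.
  by apply: le_trans; rewrite le_max lexx orbT.
have [m um] := fin_ubound u.
have {}KP s : log_map lam (fun k => u k + b s k) i <= K + m.
  apply: le_trans (lerD (KP s) (lexx m)); rewrite -log_map_homogeneous.
  by apply: log_map_le => k; rewrite addrC lerD2l.
(* [u + b t] is the convex combination of [u + b (t / l)] and [u] with weight [l]; a small [l] then
   contradicts any increase. *)
have dl l : 0 < l -> l <= 1 ->
    log_map lam (fun k => u k + b t k) i - log_map lam u i <=
    l * (K + m - log_map lam u i).
  move=> l0 l1; have := fconv i (fun k => u k + b (t / l) k) u (ltW l0) l1.
  have -> : (fun k => l * (u k + b (t / l) k) + (1 - l) * u k) = (fun k => u k + b t k).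
    apply/funext => k; rewrite /b; case: ifP => _; last by ring.
    by field; rewrite gt_eqF.
  have := ler_wpM2l (ltW l0) (KP (t / l)); rewrite /log_map !mulrDr.
  by lra.
rewrite leNgt; apply/negP => dpos.
have := dl 1 ltr01 (lexx 1); rewrite mul1r.
move: dl dpos; rewrite -/(b t).
move: (log_map lam (fun k => u k + b t k) i) => A; move: (log_map _ u i) => B.
move=> dl dpos c0.
have cpos : 0 < K + m - B by lra.
have dp : 0 < A - B by lra.
have l0 : 0 < (A - B) / (2 * (K + m - B)) by rewrite divr_gt0 // mulr_gt0.
have l1 : (A - B) / (2 * (K + m - B)) <= 1.
  by rewrite ler_pdivrMr ?mulr_gt0 // mul1r; lra.
have := dl _ l0 l1.
have -> : (A - B) / (2 * (K + m - B)) * (K + m - B) = (A - B) / 2.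
  by field; rewrite gt_eqF.
by lra.
Qed.

(** Coordinates without an arc are raised from [v j] to the maximum with [u j] one at a time, at no
    cost by [log_map_no_arc]; plain monotonicity then compares with [u]. *)
Lemma log_map_monotone_along lam : monotone_along (log_map lam) (graph_rel f).
Proof.
move=> i u v uv; pose w (s : seq 'I_n) : vec R n := fun j =>
  if (j \in s) && ~~ graph_rel f i j then Num.max (u j) (v j) else v j.
suff wv s : log_map lam (w s) i <= log_map lam v i.
  apply: le_trans (wv (enum 'I_n)); apply: log_map_le => j.
  rewrite /w mem_enum /=; have [/uv //|_ /=] := boolP (graph_rel f i j).
  by rewrite le_max lexx.
elim: s => [|j s IH]; first exact: log_map_le.
apply: le_trans IH; have [ij|nij] := boolP (graph_rel f i j).
  apply: log_map_le => k; rewrite /w in_cons; case: eqP => [->|//].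
  by rewrite ij /= andbF.
have t0 : 0 <= Num.max (u j) (v j) - v j by rewrite subr_ge0 le_max lexx orbT.
apply: le_trans (log_map_no_arc lam nij (w s) t0).
apply: log_map_le => k; rewrite /w in_cons; case: eqP => [->|_] /=; last by rewrite addr0.
by rewrite nij andbT /=; case: ifP => _; rewrite ?lerDl // addrC subrK.
Qed.

End Convexity.

Lemma ext_le C x i : pos x -> ext f (proj0 C x) i <= f x i.
Proof.
move=> xpos; apply/ler_addgt0Pr => eps eps0.
have [m m0 mx] := @fin_gap R _ (finset.setTfor 'I_n) (fun=> 0) x (fun i _ => xpos i).
(* Scaling [x] by [1 + q] raises [f x i] by exactly [eps], and [proj0 C x] shifted by [q * m] stays
   below the scaled vector. *)
have fx := fpos xpos i; pose q := eps / f x i; have q0 : 0 < q by apply: divr_gt0.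
have -> : f x i + eps = f (vscale (1 + q) x) i.
  by rewrite fhom ?addr_gt0 // /vscale mulrDl mul1r /q divfK // gt_eqF.
have ypos : pos (fun k => proj0 C x k + q * m).
  move=> k; apply: ltr_wpDl; last exact: mulr_gt0.
  by rewrite /proj0; case: ifP => // _; apply/ltW.
apply: (@le_trans _ _ (f (fun k => proj0 C x k + q * m) i)).
  apply: ge_inf; last by exists (q * m) => //; apply: mulr_gt0.
  exists 0 => _ [t t0 <-]; apply/ltW/fpos => k; apply: ltr_wpDl => //.
  by rewrite /proj0; case: ifP => // _; apply/ltW.
apply: fmono => // [k|k]; first by rewrite mulr_gt0 // addr_gt0.
rewrite /vscale mulrDl mul1r lerD //.
  by rewrite /proj0; case: ifP => // _; apply/ltW.
by rewrite ler_wpM2l ?(ltW q0) // -[m]add0r mx // finset.in_setT.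
Qed.

Lemma ext_lt_witness C x i y : pos x -> ext f (proj0 C x) i < y ->
  exists2 t, 0 < t & f (fun k => proj0 C x k + t) i < y.
Proof.
move=> xpos xy; pose S := [set f (fun k => proj0 C x k + t) i | t in [set t : R | 0 < t]].
have H : has_inf S.
  split; first by exists (f (fun k => proj0 C x k + 1) i), 1 => //=.
  exists 0 => _ [t t0 <-]; apply/ltW/fpos => k; apply: ltr_wpDl => //.
  by rewrite /proj0; case: ifP => // _; apply/ltW.
have eps0 : 0 < y - ext f (proj0 C x) i by rewrite subr_gt0.
have [_ [t t0 <-]] := inf_adherent eps0 H.
by rewrite [X in _ < X]addrC subrK; exists t.
Qed.

Lemma cw_radius_contracts lam C : contracts (log_map lam) C ->
  cw_radius (fJ0 f C) < expR lam.
Proof.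
move=> [w wC]; apply: (@cw_radius_lt _ _ _ _ (vexp w)); rewrite ?expR_gt0 //.
  exact: vexp_pos.
move=> i; rewrite /fJ0 {1}/proj0; case: ifP => [iC|_].
  apply: le_lt_trans (ext_le C i (vexp_pos w)) _.
  by rewrite -log_map_lt; apply: wC.
by rewrite mulr_gt0 ?expR_gt0.
Qed.

(** As the inequalities are strict, the zero entries off [C] can be replaced by one small constant
    [m = exp (- K)]. The cut vector is what [super_glue] consumes. *)
Lemma cw_radius_cut lam C : cw_radius (fJ0 f C) < expR lam ->
  exists w K, forall i, i \in C -> log_map lam (cutoff C w K) i < w i.
Proof.
move=> /cw_radius_lt_witness[x xpos fx].
have /choice[t tP] i : exists t, i \in C ->
    0 < t /\ f (fun k => proj0 C x k + t) i < expR lam * x i.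
  have [iC|_] := boolP (i \in C); last by exists 0.
  have := fx i; rewrite /fJ0 {1}/proj0 iC => /(ext_lt_witness xpos)[t t0 h].
  by exists t.
have [m m0 mt] := @fin_gap R _ C (fun=> 0) t (fun i iC => (tP i iC).1).
exists (vln x), (- ln m) => i iC; rewrite log_map_lt [expR (vln x i)](_ : _ = x i); last first.
  by rewrite lnK // posrE.
apply: le_lt_trans (tP i iC).2; have := mt i iC; rewrite add0r => mti.
have t0 := (tP i iC).1.
apply: fmono; first exact: vexp_pos.
  by move=> k; apply: ltr_wpDl => //; rewrite /proj0; case: ifP => // _; apply/ltW.
move=> k; rewrite /vexp /cutoff /proj0; case: ifP => _.
  by rewrite lnK ?posrE // lerDl ltW.
by rewrite opprK lnK ?posrE // add0r.
Qed.

End LogCoordinates.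

(** * Identity theorem along rays *)

Section RightContinuation.
Variable R : realType.

Section MonomialSums.
(** [L N] lists degree-coefficient pairs of the [N]-th partial sum; degrees may repeat, so
    multivariate terms enter without regrouping. *)
Variables (L : nat -> seq (nat * R)) (s0 B : R).
Hypotheses (s0_gt0 : 0 < s0)
  (LB : forall N, \sum_(p <- L N) `|p.2| * s0 ^+ p.1 <= B).

Let tail m N s := \sum_(p <- L N | (m <= p.1)%N) p.2 * s ^+ p.1.
Let coef m N := \sum_(p <- L N | p.1 == m) p.2.

Let tail_bound m N s : `|s| <= s0 -> `|tail m N s| <= (`|s| / s0) ^+ m * B.
Proof.
move=> ss0; have q0 : 0 <= `|s| / s0 by rewrite divr_ge0 // ltW.
have q1 : `|s| / s0 <= 1 by rewrite ler_pdivrMr // mul1r.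
apply: le_trans (ler_norm_sum _ _ _) _.
apply: (@le_trans _ _ (\sum_(p <- L N) (`|s| / s0) ^+ m * (`|p.2| * s0 ^+ p.1))); last first.
  by rewrite -mulr_sumr ler_wpM2l // exprn_ge0.
rewrite big_mkcond; apply: ler_sum => p _; case: ifP => mp; last first.
  by rewrite !mulr_ge0 ?exprn_ge0 // ltW.
rewrite normrM normrX mulrCA ler_wpM2l //.
have s0_neq0 : s0 != 0 by rewrite gt_eqF.
rewrite -{1}[`|s|](divfK s0_neq0) exprMn ler_wpM2r //.
  by rewrite exprn_ge0 // ltW.
exact: ler_wiXn2l.
Qed.

Let tailS m N s : tail m N s = coef m N * s ^+ m + tail m.+1 N s.
Proof.
rewrite /tail (bigID (fun p : nat * R => p.1 == m)) /=; congr (_ + _).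
  rewrite /coef mulr_suml; apply: eq_big => [p|p /andP[_ /eqP->] //].
  by case: eqP => [->|]; rewrite ?leqnn ?andbF.
by apply: eq_bigl => p; rewrite ltn_neqAle eq_sym andbC.
Qed.

(** At [s = - r] the degree-[m] term is a difference of two tails: the first tends to 0, the second
    is of order [r ^ (m + 1)] uniformly in [N]. Divide by [r ^ m] with [r] small. *)
Let coef_cvg0 m : (forall s, - s0 < s -> s < 0 -> tail m N s @[N --> \oo] --> 0) ->
  coef m N @[N --> \oo] --> 0.
Proof.
move=> tm; have B0 : 0 <= B.
  apply: le_trans (LB 0%N); apply: sumr_ge0 => p _.
  by apply: mulr_ge0 => //; apply/exprn_ge0/ltW.
apply/cvgrPdist_lt => eps eps0.
pose r := Num.min (s0 / 2) (eps / 2 * s0 ^+ m.+1 / (B + 1)).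
have B1 : 0 < B + 1 by lra.
have r0 : 0 < r.
  rewrite lt_min divr_gt0 // divr_gt0 // mulr_gt0 //; first exact: divr_gt0.
  exact: exprn_gt0.
have rs0 : r < s0 by rewrite gt_min ltr_pdivrMr // ltr_pMr // ltr1n.
have rm0 : 0 < r ^+ m by rewrite exprn_gt0.
have rs : - s0 < - r by rewrite ltrN2.
have rN : - r < 0 by rewrite oppr_lt0.
have /cvgrPdist_lt /(_ (eps / 2 * r ^+ m)) := tm (- r) rs rN.
rewrite mulr_gt0 ?divr_gt0 // => /(_ isT); apply: filterS => N.
rewrite !sub0r !normrN => tN.
have := @tail_bound m.+1 N (- r); rewrite normrN gtr0_norm // => /(_ (ltW rs0)).
have -> : (r / s0) ^+ m.+1 * B = r * B / s0 ^+ m.+1 * r ^+ m.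
  by rewrite expr_div_n exprS; ring.
have : r * B / s0 ^+ m.+1 <= eps / 2.
  rewrite ler_pdivrMr ?exprn_gt0 //; apply: (@le_trans _ _ (r * (B + 1))).
    by apply: ler_wpM2l; [exact: ltW|rewrite lerDl].
  by rewrite -ler_pdivlMr // ge_min lexx orbT.
move=> /(ler_wpM2r (ltW rm0)) h1 h2.
have h3 : `|coef m N| * r ^+ m <= `|tail m N (- r)| + `|tail m.+1 N (- r)|.
  have -> : `|coef m N| * r ^+ m = `|coef m N * (- r) ^+ m|.
    by rewrite normrM normrX normrN (gtr0_norm r0).
  by rewrite -[coef m N * _](addrK (tail m.+1 N (- r))) -tailS ler_normB.
by rewrite -(ltr_pM2r rm0); lra.
Qed.

(* Letting s tend to 0 from the left kills the coefficients degree by degree;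
   the bound at s0 makes the tails small uniformly in N. *)
Lemma monomial_sums_cvg0_right :
  (forall s, - s0 < s -> s < 0 ->
    \sum_(p <- L N) p.2 * s ^+ p.1 @[N --> \oo] --> 0) ->
  forall s, 0 <= s -> s < s0 -> \sum_(p <- L N) p.2 * s ^+ p.1 @[N --> \oo] --> 0.
Proof.
move=> left_cvg.
have tail_cvg m : forall s, - s0 < s -> s < 0 -> tail m N s @[N --> \oo] --> 0.
  elim: m => [|m IH] s s1 s2; first exact: left_cvg.
  rewrite (_ : (fun N => tail m.+1 N s) = (fun N => tail m N s - coef m N * s ^+ m)).
    rewrite -[X in _ --> X]subr0 -[X in _ --> _ - X](mul0r (s ^+ m)).
    by apply: cvgB (IH s s1 s2) _; apply: cvgMl; apply: coef_cvg0.
  by apply/funext => N; rewrite (tailS m) addrC addKr.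
move=> s s_ge0 ss0.
have head_cvg m : tail 0 N s - tail m N s @[N --> \oo] --> 0.
  elim: m => [|m IH].
    rewrite (_ : (fun N => _) = cst 0); first exact: cvg_cst.
    by apply/funext => N; rewrite subrr.
  rewrite (_ : (fun N => tail 0 N s - tail m.+1 N s) =
      (fun N => tail 0 N s - tail m N s + coef m N * s ^+ m)).
    rewrite -[X in _ --> X]addr0 -[X in _ --> _ + X](mul0r (s ^+ m)).
    by apply: cvgD IH _; apply: cvgMl; apply: coef_cvg0; apply: tail_cvg.
  by apply/funext => N; rewrite (tailS m); ring.
apply/cvgrPdist_lt => eps eps0.
have q1 : `|s / s0| < 1.
  rewrite ger0_norm; last by rewrite divr_ge0 // ltW.
  by rewrite ltr_pdivrMr // mul1r.
have [m qm] : exists m, (s / s0) ^+ m * B < eps / 2.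
  have := cvgMl (cvg_expr q1); move=> /(_ _ B); rewrite mul0r => /cvgrPdist_lt.
  move=> /(_ (eps / 2)); rewrite divr_gt0 // => /(_ isT)[m _ /(_ m (leqnn m))] /=.
  by rewrite sub0r normrN => h; exists m; apply: le_lt_trans h; apply: ler_norm.
have /cvgrPdist_lt /(_ (eps / 2)) := head_cvg m; rewrite divr_gt0 // => /(_ isT).
apply: filterS => N; rewrite !sub0r !normrN.
have := @tail_bound m N s; rewrite ger0_norm // => /(_ (ltW ss0)) t1 t2.
have : `|tail 0 N s| <= `|tail 0 N s - tail m N s| + `|tail m N s|.
  by rewrite -{1}(subrK (tail m N s) (tail 0 N s)) ler_normD.
by rewrite /tail; lra.
Qed.

End MonomialSums.

Variable n : nat.
Implicit Types (g : vec R n -> R) (x p d : vec R n).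

(** On the line through [p] in direction [d] the power series becomes a sequence of monomial sums in
    [s], covered by [monomial_sums_cvg0_right]. *)
Lemma real_analytic_at_right g p d c r0 : real_analytic_at g p -> pos p -> nonneg d ->
  0 < r0 -> (forall s, - r0 < s -> s < 0 -> g (fun k => p k + s * d k) = c) ->
  exists2 r, 0 < r & forall s, 0 <= s -> s < r -> g (fun k => p k + s * d k) = c.
Proof.
move=> [del del0 [a aP]] ppos d0 r00 gc.
have [m m0 mp] := @fin_gap R _ (finset.setTfor 'I_n) (fun=> 0) p (fun i _ => ppos i).
have [D DP] := fin_ubound (fun k => d k).
pose E := Num.max 1 D; have E0 : 0 < E by rewrite lt_max ltr01.
have dE k : d k <= E by rewrite le_max DP orbT.
(* For [|s| <= s0] the points stay in the orthant and in the cube of convergence. *)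
pose s0 := Num.min r0 (Num.min del m / E / 2).
have s00 : 0 < s0 by rewrite lt_min r00 !divr_gt0 // lt_min del0.
have sd k s : `|s| <= s0 -> `|s * d k| < Num.min del m.
  move=> ss; rewrite normrM (ger0_norm (d0 k)).
  apply: (@le_lt_trans _ _ (s0 * E)); first by rewrite ler_pM // d0.
  apply: (@le_lt_trans _ _ (Num.min del m / E / 2 * E)).
    by apply: ler_wpM2r; [exact: ltW|rewrite ge_min lexx orbT].
  have mm : 0 < Num.min del m by rewrite lt_min del0.
  by rewrite mulrAC divfK ?gt_eqF // ltr_pdivrMr //; lra.
have ypos s : `|s| <= s0 -> pos (fun k => p k + s * d k).
  move=> ss k; have := sd k s ss; rewrite lt_min => /andP[_].
  have := mp k (finset.in_setT k); rewrite ltr_norml add0r => h /andP[h' _]; lra.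
have ydel s : `|s| <= s0 -> forall k, `|p k + s * d k - p k| < del.
  by move=> ss k; rewrite addrC addKr; have := sd k s ss; rewrite lt_min => /andP[].
pose A (al : 'I_n -> nat) := a al * \prod_(k < n) d k ^+ al k.
have termE s al : ps_term a p (fun k => p k + s * d k) al =
    A al * s ^+ (\sum_(k < n) al k)%N.
  rewrite /ps_term /A -mulrA; congr (_ * _).
  rewrite -prodrXr -big_split /=; apply: eq_bigr => k _.
  by rewrite addrC addKr exprMn mulrC.
pose al2nat N (al : {ffun 'I_n -> 'I_N.+1}) k := nat_of_ord (al k).
(* The leading pair subtracts [c], so that the sums tend to 0 on the left. *)
pose L N := (0%N, - c) :: [seq ((\sum_(k < n) al2nat N al k)%N, A (al2nat N al))
  | al <- index_enum {ffun 'I_n -> 'I_N.+1}].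
have sumL N s : \sum_(q <- L N) q.2 * s ^+ q.1 =
    ps_partial (ps_term a p (fun k => p k + s * d k)) N - c.
  rewrite /L big_cons big_map /= expr0 mulr1 addrC; congr (_ + _).
  by apply: eq_bigr => al _; rewrite termE.
have s0n : `|s0| <= s0 by rewrite gtr0_norm.
have [[B BP] _] := aP _ (ypos s0 s0n) (ydel s0 s0n).
have LB N : \sum_(q <- L N) `|q.2| * s0 ^+ q.1 <= `|c| + B.
  rewrite /L big_cons big_map /= expr0 mulr1 normrN lerD2l.
  apply: le_trans (BP N); apply: ler_sum => al _.
  by rewrite termE [leRHS]normrM normrX (gtr0_norm s00).
have gcvg s : `|s| <= s0 -> \sum_(q <- L N) q.2 * s ^+ q.1 @[N --> \oo] -->
    g (fun k => p k + s * d k) - c.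
  move=> ss; rewrite (_ : (fun N => _) = (fun N =>
    ps_partial (ps_term a p (fun k => p k + s * d k)) N - c)); last first.
    by apply/funext => N.
  apply: cvgB; last exact: cvg_cst.
  by have [_] := aP _ (ypos s ss) (ydel s ss).
exists s0 => // s s_ge0 ss0; apply/eqP; rewrite -subr_eq0; apply/eqP.
have ss : `|s| <= s0 by rewrite ger0_norm // ltW.
apply: cvg_unique (gcvg s ss) _; first exact: Rhausdorff.
apply: monomial_sums_cvg0_right s_ge0 ss0 => // t t1 t2.
have s0r0 : s0 <= r0 by rewrite ge_min lexx.
have tr0 : - r0 < t by apply: le_lt_trans t1; rewrite lerN2.
have e : g (fun k => p k + t * d k) - c = 0 by rewrite gc // subrr.
rewrite -[X in _ --> X]e.
by apply: gcvg; rewrite ltr0_norm // lerNl ltW.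
Qed.

(** If the interval of constancy had a finite supremum, [real_analytic_at_right] there would
    continue the value [c] past it. *)
Lemma real_analytic_ray g x d c : (forall y, pos y -> real_analytic_at g y) ->
  pos x -> nonneg d ->
  (forall s, 0 <= s -> s <= 1 -> g (fun k => x k + s * d k) = c) ->
  forall s, 0 <= s -> g (fun k => x k + s * d k) = c.
Proof.
move=> gan xpos d0 g1 t t0; apply: contrapT => gt.
pose S := [set u : R | 0 <= u /\ forall s, 0 <= s -> s <= u -> g (fun k => x k + s * d k) = c].
have S1 : S 1 by split.
have Sub : has_sup S.
  split; first by exists 1.
  by exists t => u [u0 uP]; rewrite leNgt; apply/negP => tu; apply: gt; apply/uP/ltW.
have T1 : 1 <= sup S := sup_upper_bound Sub S1.
have gT s : 0 <= s -> s < sup S -> g (fun k => x k + s * d k) = c.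
  move=> s0 sS; have e0 : 0 < sup S - s by rewrite subr_gt0.
  have [u [u0 uP]] := sup_adherent e0 Sub; rewrite subKr => /ltW; exact: uP.
have shift s : (fun k => x k + sup S * d k + s * d k) = (fun k => x k + (sup S + s) * d k).
  by apply/funext => k; rewrite mulrDl addrA.
have ppos : pos (fun k => x k + sup S * d k).
  by move=> k; apply: ltr_wpDr (xpos k); rewrite mulr_ge0 //; lra.
have [|s s1 s2|r r0 rP] := real_analytic_at_right (gan _ ppos) ppos d0 (r0 := sup S) (c := c).
- by lra.
- by rewrite shift gT //; lra.
have : S (sup S + r / 2).
  split=> [|s s0 sr]; first by lra.
  have [sS|Ss] := ltP s (sup S); first exact: gT.
  have := rP (s - sup S); rewrite subr_ge0 Ss => /(_ isT).
  have -> : s - sup S < r by lra.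
  by move=> /(_ isT); rewrite shift addrC subrK.
by move=> /(sup_upper_bound Sub); lra.
Qed.

End RightContinuation.

(** * Eigenvectors and fixed points *)

Section HilbertMetric.
Variables (R : realType) (n : nat).
Implicit Types u v : vec R n.

Let ratioE u v i j : vexp v i * vexp u j / (vexp u i * vexp v j) =
  expR (v i - u i - (v j - u j)).
Proof. by rewrite /vexp invfM -!expRN -!expRD; congr expR; ring. Qed.

(** In logarithmic coordinates [dH] is the oscillation of [v - u]. *)
Lemma dH_ge u v i j : v i - u i - (v j - u j) <= dH (vexp u) (vexp v).
Proof.
have H : expR (v i - u i - (v j - u j)) <= \big[Num.max/0]_(i < n) \big[Num.max/0]_(j < n)
    (vexp v i * vexp u j / (vexp u i * vexp v j)).
  by apply: le_trans (le_bigmax _ _ i); apply: le_trans (le_bigmax _ _ j); rewrite ratioE.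
by rewrite -[leLHS]expRK /dH ler_ln ?posrE ?expR_gt0 // (lt_le_trans (expR_gt0 _) H).
Qed.

Lemma dH_le u v M : (0 < n)%N -> (forall i j, v i - u i - (v j - u j) <= M) ->
  dH (vexp u) (vexp v) <= M.
Proof.
move=> n0 uvM; rewrite -[leRHS]expRK /dH ler_ln ?posrE ?expR_gt0 //; last first.
  (* A diagonal ratio, equal to 1, makes the maximum positive, as [ler_ln] requires. *)
  have i : 'I_n := Ordinal n0.
  apply: (@lt_le_trans _ _ (vexp v i * vexp u i / (vexp u i * vexp v i))).
    by rewrite ratioE expR_gt0.
  by apply: le_trans (le_bigmax _ _ i); apply: le_trans (le_bigmax _ _ i).
apply: bigmax_le => [|i _]; first exact/ltW/expR_gt0.
apply: bigmax_le => [|j _]; first exact/ltW/expR_gt0.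
by rewrite ratioE ler_expR.
Qed.

End HilbertMetric.

Section Eigenvectors.
Variables (R : realType) (n : nat) (f : vec R n -> vec R n).
Hypotheses (n_gt0 : (0 < n)%N) (fpos : maps_pos f) (fmono : order_preserving f)
  (fhom : homogeneous f) (fconv : mult_convex f).

Let i0 : 'I_n := Ordinal n_gt0.
Let e := graph_rel f.
Let Tmono lam := log_map_monotone_along fpos fmono fhom fconv lam.
Let Thom lam := log_map_homogeneous fpos fhom lam.
Let Tcoer lam := log_map_coercive fpos lam.

Lemma cw_radius_log_map lam :
  cw_radius f < expR lam <-> contracts (log_map f lam) (finset.setTfor 'I_n).
Proof.
split=> [/cw_radius_lt_witness[x xpos fx]|[w Tw]].
  exists (vln x) => i _; rewrite (log_map_lt fpos) vlnK // lnK ?posrE //.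
apply: (@cw_radius_lt _ _ _ _ (vexp w)); rewrite ?expR_gt0 //; first exact: vexp_pos.
by move=> i; rewrite -(log_map_lt fpos); apply: Tw; apply: finset.in_setT.
Qed.

(** All entries of [f] at the vector of ones are at least [expR m], so the maximum principle forbids
    contraction at level [m]. *)
Lemma cw_radius_gt0 : 0 < cw_radius f.
Proof.
have [m mf] := fin_lbound (log_map f 0 (fun=> 0)).
apply: (lt_le_trans (expR_gt0 m)); rewrite leNgt; apply/negP.
move=> /cw_radius_log_map[w Tw].
apply: (le_of_contracting (@Tmono m) (@Thom m) (v := fun=> 0) _ (finset.in_setT i0) _ Tw).
  by move=> i j _ _; apply: finset.in_setT.
by move=> i _; have := mf i; rewrite /log_map subr0 subr_ge0.
Qed.

Let lam := ln (cw_radius f).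
Let T := log_map f lam.

Let expR_lam : expR lam = cw_radius f.
Proof. by rewrite lnK // posrE cw_radius_gt0. Qed.

Lemma log_map_shift_level mu nu v i : log_map f mu v i = log_map f nu v i + nu - mu.
Proof. by rewrite /log_map subrK. Qed.

(** A radius below [expR mu] contradicts the maximum principle; if [mu < lam], then [v] itself is
    strictly contracted at level [lam]. *)
Lemma fixed_point_level mu v : (forall i, log_map f mu v i = v i) -> mu = lam.
Proof.
move=> fixv; apply: expR_inj; rewrite expR_lam; apply/eqP.
rewrite eq_le !leNgt; apply/andP; split; apply/negP.
  move=> /cw_radius_log_map[w Tw].
  apply: (le_of_contracting (@Tmono mu) (@Thom mu) (v := v) _ (finset.in_setT i0) _ Tw).
    by move=> i j _ _; apply: finset.in_setT.
  by move=> i _; rewrite fixv.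
rewrite -expR_lam ltr_expR => ml.
suff : cw_radius f < expR lam by rewrite expR_lam ltxx.
apply/cw_radius_log_map; exists v => i _.
by rewrite (log_map_shift_level _ mu) fixv; lra.
Qed.

Lemma eigvecs_fixed_point x :
  eigvecs f x <-> exists2 u, x = vexp u & forall i, T u i = u i.
Proof.
split=> [[xpos [mu fx]]|[u -> Tu]]; last first.
  split; first exact: vexp_pos.
  exists (expR lam); apply/funext => i.
  by rewrite -(expR_log_map fpos lam) -/T Tu expRD mulrC.
have mu0 : 0 < mu.
  have := fpos xpos i0; rewrite fx /vscale pmulr_lgt0 //; exact: xpos.
exists (vln x) => [|i]; first by rewrite vlnK.
have fixx j : log_map f (ln mu) (vln x) j = vln x j.
  by rewrite /log_map vlnK // fx /vscale lnM ?posrE // addrC addKr.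
by rewrite /T -(fixed_point_level fixx).
Qed.

Lemma contracts_radius C : contracts T C -> cw_radius (fJ0 f C) < cw_radius f.
Proof. by move=> /(cw_radius_contracts fpos fmono fhom); rewrite expR_lam. Qed.

Lemma radius_contracts (C : {set 'I_n}) : cw_radius (fJ0 f C) < cw_radius f -> contracts T C.
Proof.
rewrite -expR_lam => /(cw_radius_cut fpos fmono)[w [K TC]].
by exists (cutoff C w K) => i iC; rewrite [ltRHS]cutoff_in //; apply: TC.
Qed.

Lemma closed_class_not_contracts v (D : {set 'I_n}) i : (forall i, T v i = v i) ->
  closed_set e D -> i \in D -> ~ contracts T D.
Proof.
move=> Tv Dcl iD [w Tw].
by apply: (le_of_contracting (@Tmono lam) (@Thom lam) (v := v) Dcl iD _ Tw) => j _; rewrite -/T Tv.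
Qed.

(** A larger radius on [D] would let [v] be strictly contracted at that level; a smaller one
    contradicts the maximum principle on [D]. *)
Lemma closed_class_radius v (D : {set 'I_n}) i : (forall i, T v i = v i) ->
  closed_set e D -> i \in D -> cw_radius (fJ0 f D) = cw_radius f.
Proof.
move=> Tv Dcl iD; apply/eqP; rewrite eq_le !leNgt; apply/andP; split; apply/negP.
  move=> lt; have rD : expR (ln (cw_radius (fJ0 f D))) = cw_radius (fJ0 f D).
    by rewrite lnK // posrE (lt_trans cw_radius_gt0).
  suff : cw_radius (fJ0 f D) < expR (ln (cw_radius (fJ0 f D))) by rewrite rD ltxx.
  apply: cw_radius_contracts => //; exists v => j _.
  rewrite (log_map_shift_level _ lam) -/T Tv.
  by move: lt; rewrite -[ltRHS]rD -expR_lam ltr_expR; lra.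
by move=> /radius_contracts; apply: closed_class_not_contracts Tv Dcl iD.
Qed.

(** On a final class, equal radii give supersolutions up to every [eps], and [super_attained]
    removes [eps]. On other classes the strict inequality gives a strict one. *)
Lemma strongly_nonneg_super : strongly_nonneg f -> exists z, forall i,
  T z i <= z i /\ (~ closed_set e (class_of e i) -> T z i < z i).
Proof.
move=> [fin nonfin]; apply: (super_glue (@Tmono lam) (@Thom lam)) => i; set C := class_of e i.
have [Ccl|nCcl] := pselect (closed_set e C).
  have [eps eps0|w Tw] := super_attained (@Tmono lam) (@Thom lam) (@Tcoer lam) Ccl.
  - have : cw_radius (fJ0 f C) < expR (lam + eps).
      by rewrite fin ?expRD ?expR_lam ?ltr_pMr ?cw_radius_gt0 ?expR_gt1 //; split => //; exists i.
    move=> /(cw_radius_cut fpos fmono)[w [K TC]]; exists (cutoff C w K) => j jC.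
    have := TC j jC; rewrite (log_map_shift_level _ lam) [cutoff C w K j]cutoff_in // -/T.
    by rewrite opprD addrA addrK ltrBlDr => /ltW.
  exists w, 0 => j jC; split=> [|//]; apply: le_trans (Tw j jC); apply: Tmono => k jk.
  by rewrite cutoff_in // (Ccl _ _ jC jk).
have /(nonfin C) : scc f C by exists i.
rewrite -expR_lam => /(_ (fun h => nCcl h.2)) /(cw_radius_cut fpos fmono)[w [K TC]].
by exists w, K => j jC; split => [|_]; [apply/ltW|]; apply: TC.
Qed.

Lemma strongly_nonneg_eigvecs : strongly_nonneg f -> eigvecs f !=set0.
Proof.
move=> fsn; have [z Tz] := strongly_nonneg_super fsn.
have [||u Tu] := fixed_point_exists (@Tmono lam) (@Thom lam) (@Tcoer lam) (z := z).
- by move=> i; have [] := Tz i.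
- move=> i Ccl /contracts_radius; rewrite fsn.1 ?ltxx //.
  by split => //; exists i.
by exists (vexp u); apply/eigvecs_fixed_point; exists u.
Qed.

Lemma strongly_nonneg_bounded : strongly_nonneg f -> unique_final_class f ->
  dH_bounded (eigvecs f).
Proof.
move=> fsn [C [[[j Cj] Ccl] Cuniq]]; have [z Tz] := strongly_nonneg_super fsn.
have final i : closed_set e (class_of e i) -> class_of e i = class_of e j.
  by move=> icl; rewrite (Cuniq (class_of e i)) //; split => //; exists i.
have [|||M MP] := fixed_points_bounded (@Tmono lam) (@Thom lam) (@Tcoer lam) (z := z) (i0 := j).
- by move=> i; have [] := Tz i.
- move=> i iC; apply: (Tz i).2 => /final ij; move: iC.
  by rewrite -ij class_of_refl.
- move=> i; have [k ik /final kj] := connect_closed_class e i.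
  apply: connect_trans ik _.
  by have := class_of_refl e j; rewrite -kj inE => /andP[].
exists (M + M) => x y /eigvecs_fixed_point[u -> Tu] /eigvecs_fixed_point[v -> Tv].
apply: dH_le => // k l; have := MP u Tu l k; have := MP v Tv k l.
by lra.
Qed.

(** Otherwise [fixed_point_raise] lifts some index of the class by [|M| + 1] while fixing [b],
    giving two eigenvectors farther apart than [M]. *)
Lemma bounded_contracts v i b : (forall i, T v i = v i) -> dH_bounded (eigvecs f) ->
  ~~ [exists c in class_of e i, connect e b c] -> contracts T (class_of e i).
Proof.
move=> Tv [M MP] nb; apply: contrapT => nC.
have [||u [c [Tu cC uc _ ub]]] := fixed_point_raise (@Tmono lam) (@Thom lam)
  (v := v) (s := `|M| + 1) _ nC; rewrite ?addr_ge0 //.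
have := dH_ge v u c b; have : dH (vexp v) (vexp u) <= M.
  by apply: MP; apply/eigvecs_fixed_point; [exists v|exists u].
by rewrite uc ub //; have := ler_norm M; lra.
Qed.

Lemma nonclosed_class_escape i : ~ closed_set e (class_of e i) ->
  exists2 b, (forall c, c \in class_of e i -> connect e c b) &
    ~~ [exists c in class_of e i, connect e b c].
Proof.
move=> ncl; apply: contrapT => H; apply: ncl => a b aC ab.
apply: contrapT => nb; apply: H; exists b.
  move=> c cC; apply: connect_trans (connect1 ab); move: aC cC; rewrite !inE.
  by move=> /andP[ia _] /andP[_ ci]; apply: connect_trans ia.
apply/negP => /existsP[c /andP[cC bc]]; apply: nb; move: aC cC; rewrite !inE.
move=> /andP[ia ai] /andP[ic ci]; rewrite (connect_trans ia (connect1 ab)) /=.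
exact: connect_trans ci.
Qed.

Lemma bounded_strongly_nonneg : eigvecs f !=set0 -> dH_bounded (eigvecs f) ->
  strongly_nonneg f /\ unique_final_class f.
Proof.
move=> [x /eigvecs_fixed_point[v _ Tv]] bnd; split; first split.
- move=> _ [[i ->] icl]; exact: closed_class_radius Tv icl (class_of_refl e i).
- move=> _ [i ->] nfin; apply: contracts_radius.
  have [|b _ nb] := @nonclosed_class_escape i; last exact: bounded_contracts bnd nb.
  by move=> icl; apply: nfin; split => //; exists i.
have [j _ jcl] := connect_closed_class e i0; exists (class_of e j).
split; first by split => //; exists j.
move=> _ [[k ->] kcl]; apply: contrapT => kj.
apply: (closed_class_not_contracts Tv jcl (class_of_refl e j)).
(* A second final class, that of [k], cannot lead to the class of [j], which would therefore
   contract. *)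
apply: (bounded_contracts (b := k) Tv bnd); apply/negP => /existsP[c /andP[cj kc]].
have := closed_set_connect kcl (class_of_refl e k) kc.
by move=> /class_of_eq ck; apply: kj; apply: etrans (esym ck) (class_of_eq cj).
Qed.

(** Monotonicity makes entry [i] constant on the segment, and analyticity on the whole ray. If
    [u j < w j], coordinate [j] is unbounded there, against the arc. *)
Lemma analytic_arc_eq u w i j : (forall y, pos y -> real_analytic_at (fun y => f y i) y) ->
  (forall k, u k <= w k) -> f (vexp u) i = f (vexp w) i -> e i j -> u j = w j.
Proof.
move=> fan uw fuw ij; apply/eqP; rewrite eq_le uw leNgt; apply/negP => uwj.
pose x := vexp u; pose d : vec R n := fun k => vexp w k - x k.
have xpos : pos x := vexp_pos u.
have d0 : nonneg d by move=> k; rewrite subr_ge0 ler_expR.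
have dj : 0 < d j by rewrite subr_gt0 ltr_expR.
have ray := real_analytic_ray fan xpos d0 (c := f x i).
have {}ray s : 0 <= s -> f (fun k => x k + s * d k) i = f x i.
  apply: ray => {}s s0 s1; have ypos : pos (fun k => x k + s * d k).
    by move=> k; apply: ltr_wpDr (xpos k); rewrite mulr_ge0.
  apply/eqP; rewrite eq_le; apply/andP; split.
    rewrite fuw; apply: fmono => //; first exact: vexp_pos.
    move=> k; have := ler_piMl (d0 k) s1; rewrite /d; lra.
  by apply: fmono => // k; rewrite lerDl mulr_ge0.
have [m m0 mx] := @fin_gap R _ (finset.setTfor 'I_n) (fun=> 0) x (fun i _ => xpos i).
(* By homogeneity, [f] at [vscale m (exp_te j B)] then has entry [i] at least [f x i + 1]; [s] below
   makes the ray dominate that vector. *)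
have /asboolP/(_ ((f x i + 1) / m))[B /(_ B (lexx B))] := ij.
rewrite ler_pdivrMr // => fB.
pose s := m * expR B / d j; have s0 : 0 <= s.
  by rewrite divr_ge0 ?mulr_ge0 ?expR_ge0 ?ltW.
have ypos : pos (fun k => x k + s * d k).
  by move=> k; apply: ltr_wpDr (xpos k); rewrite mulr_ge0.
have Epos : pos (exp_te j B).
  by move=> k; rewrite /exp_te; case: ifP; rewrite ?expR_gt0.
have : f (vscale m (exp_te j B)) i <= f (fun k => x k + s * d k) i.
  apply: fmono => // [k|k]; first by rewrite mulr_gt0.
  rewrite /vscale /exp_te; case: eqP => [->|_].
    by rewrite /s divfK ?gt_eqF // lerDr ltW.
  rewrite mulr1; have := mx k (finset.in_setT k).
  by have := mulr_ge0 s0 (d0 k); lra.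
by rewrite fhom // /vscale ray //; lra.
Qed.

Lemma analytic_strongly_nonneg : real_analytic f -> eigvecs f !=set0 -> strongly_nonneg f.
Proof.
move=> fan [x /eigvecs_fixed_point[v _ Tv]]; split.
  move=> _ [[i ->] icl]; exact: closed_class_radius Tv icl (class_of_refl e i).
move=> _ [i ->] nfin; apply: contracts_radius; apply: contrapT => nC.
have [|b Cb nb] := @nonclosed_class_escape i.
  by move=> icl; apply: nfin; split => //; exists i.
have [u [c [Tu cC uc uv ub]]] :=
  fixed_point_raise (@Tmono lam) (@Thom lam) Tv nC ler01.
(* The indices raised in full: closed under arcs and containing [c], hence also the unraised [b], a
   contradiction. *)
pose J : {set 'I_n} := finset (fun k => u k == v k + 1).
have Jcl : closed_set e J.
  move=> k l; rewrite inE => /eqP uk kl.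
  have uw : f (vexp u) k = f (vexp (fun k => v k + 1)) k.
    by rewrite -!(expR_log_map fpos lam) Thom Tu [log_map f lam v k]Tv uk.
  by rewrite inE (analytic_arc_eq (fan k) uv uw kl).
have cJ : c \in J by rewrite inE uc.
have := closed_set_connect Jcl cJ (Cb c cC); rewrite inE ub // => /eqP; lra.
Qed.

End Eigenvectors.

Theorem theorem4p4 (R : realType) (n : nat) (f : vec R n -> vec R n) :
  (0 < n)%N ->
  maps_pos f -> order_preserving f -> homogeneous f -> mult_convex f ->
  [/\ (eigvecs f !=set0 /\ dH_bounded (eigvecs f)) <->
        (strongly_nonneg f /\ unique_final_class f),
      strongly_nonneg f -> eigvecs f !=set0
    & real_analytic f -> eigvecs f !=set0 -> strongly_nonneg f].
Proof.
move=> n_gt0 fpos fmono fhom fconv; split.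
- split=> [[E bnd]|[fsn funiq]]; first exact: bounded_strongly_nonneg.
  by split; [exact: strongly_nonneg_eigvecs|exact: strongly_nonneg_bounded].
- exact: strongly_nonneg_eigvecs.
- exact: analytic_strongly_nonneg.
Qed.
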